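(* Let $0<k\le 1$, let $s,n$ be integers with $0\le s<n$, let $z_0\in\mathbb{C}$ with $|z_0|>1$, and let $P(z)=(z-z_0)^s\sum_{v=0}^{n-s}c_vz^v$ (with $c_v\in\mathbb{C}$, $c_0\ne 0$) be a polynomial of degree $n$ having no zeros in $|z|>k$ except a zero of order $s$ at $z_0$. Then for every complex number $\gamma$ with $|\gamma|\le 1$, every real $\alpha$, and every $z\in\mathbb{C}$ with $|z|=1$, $$|D_\gamma P(z)|\le\frac n2\left[2|\gamma|\max_{|w|=1}|P(w)|+(1-|\gamma|)\left\{M_\alpha^2+M_{\alpha+\pi}^2-2\left\{1-\frac2n\left\{\frac{s|z_0|}{|z_0|-1}+\frac{(n-s)k}{k+1}-\frac{k}{k+1}\left(\frac{|c_{n-s}|k^{n-s}-|c_0|}{|c_{n-s}|k^{n-s}+|c_0|}\right)\right\}\right\}|P(z)|^2\right\}^{1/2}\right].$$ The result is best possible for $s=0$, $k=1$, and equality holds for $P(z)=z^n+1$.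
   Context: For a polynomial $P$ of degree $n$ and $\gamma\in\mathbb{C}$, the polar derivative of $P$ is $D_\gamma P(z)=nP(z)+(\gamma-z)P'(z)$. For real $\alpha$, $M_\alpha=\max_{1\le l\le n}\left|P\left(e^{i(\alpha+2l\pi)/n}\right)\right|$, and $M_{\alpha+\pi}$ is obtained by replacing $\alpha$ by $\alpha+\pi$. When $s=0$ the condition on zeros means that $P$ has no zeros in $|z|>k$. *)

(* Defs.v *)
From HB Require Import structures.
From mathcomp Require Import all_boot all_order all_algebra.
From mathcomp Require Import complex.
From mathcomp Require Import all_classical all_reals all_analysis.

Set Implicit Arguments.
Unset Strict Implicit.
Unset Printing Implicit Defensive.

Import Order.TTheory GRing.Theory Num.Theory.

Local Open Scope classical_set_scope.
Local Open Scope ring_scope.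
Local Open Scope complex_scope.

(* The modulus of a complex number as an element of R; the generic norm `|z|
   on R[i] takes its values in R[i]. *)
Notation modulus := ComplexField.Normc.normc.

Definition polar_deriv (R : realType) (gamma : R[i]) (P : {poly R[i]}) :
    {poly R[i]} :=
  (size P).-1%:R *: P + (gamma%:P - 'X) * P^`().

Definition cexpi (R : realType) (t : R) : R[i] := cos t +i* sin t.

Definition max_circle (R : realType) (P : {poly R[i]}) : R :=
  sup [set modulus P.[w] | w in [set w : R[i] | modulus w = 1]].

(* The neutral element 0 of the iterated maximum is harmless: the moduli are
   nonnegative and the range of l is nonempty for a nonconstant P. *)
Definition max_nodes (R : realType) (P : {poly R[i]}) (alpha : R) : R :=
  let n := (size P).-1 in
  \big[Num.max/0]_(1 <= l < n.+1)
    modulus P.[cexpi ((alpha + 2 * l%:R * pi) / n%:R)].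

(* mup z0 P = s says that z0 is a zero of order exactly s; for s = 0 it says
   that z0 is not a zero, so that P has no zeros at all in |z| > k. *)
Definition zeros_in_disk_but_one (R : realType) (n s : nat) (k : R)
    (z0 : R[i]) (c : nat -> R[i]) (P : {poly R[i]}) : Prop :=
  [/\ P = ('X - z0%:P) ^+ s * \sum_(0 <= v < (n - s).+1) c v *: 'X^v,
      c 0%N != 0,
      size P = n.+1,
      forall z : R[i], k < modulus z -> root P z -> z = z0
    & mup z0 P = s].

Definition zero_excess (R : realType) (n s : nat) (k : R) (z0 : R[i])
    (c : nat -> R[i]) : R :=
  let a := modulus (c (n - s)%N) * k ^+ (n - s) in
  let b := modulus (c 0%N) in
  s%:R * modulus z0 / (modulus z0 - 1) + (n - s)%:R * k / (k + 1)
  - k / (k + 1) * ((a - b) / (a + b)).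

(* The bracketed factor multiplying n / 2 in the upper bound. *)
Definition polar_bracket (R : realType) (n s : nat) (k : R) (z0 : R[i])
    (c : nat -> R[i]) (P : {poly R[i]}) (gamma : R[i]) (alpha : R)
    (z : R[i]) : R :=
  2 * modulus gamma * max_circle P
  + (1 - modulus gamma)
    * Num.sqrt (max_nodes P alpha ^+ 2 + max_nodes P (alpha + pi) ^+ 2
                - 2 * (1 - 2 / n%:R * zero_excess n s k z0 c)
                  * modulus P.[z] ^+ 2).

(* Main.v *)
Require Import Defs.
From HB Require Import structures.
From mathcomp Require Import all_boot all_order all_algebra.
From mathcomp Require Import complex.
From mathcomp Require Import all_classical all_reals all_analysis.
From mathcomp Require Import ring lra.

(** Write A = n P(z) - z P'(z) and B = z P'(z), with |z| = 1.

    The analytic core is one quadrature formula. Let x_1, ..., x_n be the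
    solutions of x^n = b with |b| = 1. Weighting the value P(x_l) by the Fejer
    kernel at x_l / z gives exactly A + (b / z^n) B, for every P of degree at
    most n; this only has to be checked on monomials, where it is the
    orthogonality of the n-th roots of unity. The weights are nonnegative and
    add up to n, so |A + (b / z^n) B| <= n max_l |P(x_l)|
    ([polar_bound_on_nodes]). This is used in two ways.

    - Replacing alpha by alpha + pi changes the sign of b = e^{i alpha}; hence
      both |A + u B| <= n M_alpha and |A - u B| <= n M_{alpha + pi} for some
      |u| = 1, and the parallelogram law gives
      |A|^2 + |B|^2 <= (n^2 / 2) (M_alpha^2 + M_{alpha + pi}^2)
      ([sqr_deriv_le_max_nodes]).
    - As b is arbitrary, |A + u B| <= n max_{|w| = 1} |P(w)| whenever |u| = 1.
      Since D_gamma P(z) = A + gamma P'(z) is the convex combination, with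
      weights 1 - |gamma| and |gamma|, of A and of A + u B for a suitable u,
      this leaves only |A| to be estimated ([polar_deriv_convex_bound]).

    The zeros enter through |A|^2 - |B|^2 = n (n - 2 Re (z P'/P)) |P(z)|^2.
    The logarithmic derivative is a sum over the zeros w of z / (z - w), whose
    real part is at least 1 / (1 + |w|) when |w| <= 1 and at least
    -1 / (|z_0| - 1) when w = z_0 lies outside. The term with |c_0| and
    |c_{n-s}| comes from comparing 1 / (1 + |w|) with its minimum 1 / (1 + k):
    the gain is at least k / (1 + k) times (1 - t) / (1 + t) with t = |w| / k,
    and (1 - t) / (1 + t) is subadditive along products ([cayley_prod_le]).
    Altogether Re (z P'/P) >= n - E, where E is the expression in the inner
    braces ([re_log_deriv_ge]); added to the bound on |A|^2 + |B|^2 this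
    estimates |A| ([reversed_deriv_bound]).

    For P = X^n + 1 and k = 1 one has E = n / 2, and M_alpha^2 +
    M_{alpha + pi}^2 = 4 by the parallelogram law, so that the bound is
    n (1 + |gamma|); it is reached where gamma z^{n-1} = |gamma|. *)

Set Implicit Arguments.
Unset Strict Implicit.
Unset Printing Implicit Defensive.

Import Order.TTheory GRing.Theory Num.Theory.

Local Open Scope ring_scope.

(** * A quadrature formula with Fejer weights *)

(** Multiplying the left-hand side out with [x ^+ n * y ^+ j = x ^+ (n - j)]
    gives the symmetric sum of (n - |m|) x^m over |m| < n, the Fejer kernel. The
    asymmetric form is kept because it is a polynomial in [y] as soon as
    [x ^+ n] is a known constant. *)
Lemma fejer_kernelE (A : comPzRingType) (n : nat) (x y : A) :
  x * y = 1 ->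
  \sum_(j < n) ((n - j)%:R + j%:R * x ^+ n) * y ^+ j
  = (\sum_(j < n) x ^+ j) * (\sum_(j < n) y ^+ j).
Proof.
move=> xy1.
have yxX m i : y ^+ (m + i) * x ^+ i = y ^+ m.
  by rewrite exprD -mulrA -exprMn mulrC [y * x]mulrC xy1 expr1n mul1r.
elim: n => [|n IHn]; first by rewrite !big_ord0 mul0r.
rewrite [in RHS]big_ord_recr [X in _ = _ * X]big_ord_recr /=.
rewrite mulrDl !mulrDr -IHn -exprMn xy1 expr1n -addrA.
rewrite [X in _ = _ + X]addrCA.
have -> : (\sum_(j < n) x ^+ j) * y ^+ n + 1 = \sum_(j < n.+1) y ^+ j.
  rewrite big_ord_recl expr0 addrC; congr (_ + _).
  rewrite mulr_suml (reindex_inj rev_ord_inj); apply: eq_bigr => j _ /=.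
  by rewrite mulrC -(yxX j.+1 (n - j.+1)%N) subnKC.
have -> : x ^+ n * \sum_(j < n) y ^+ j = \sum_(j < n) x ^+ n.+1 * y ^+ j.+1.
  rewrite mulr_sumr; apply: eq_bigr => j _.
  by rewrite [x ^+ n.+1]exprS [y ^+ j.+1]exprS mulrACA xy1 mul1r.
have -> : \sum_(j < n.+1) ((n.+1 - j)%:R + j%:R * x ^+ n.+1) * y ^+ j
   = \sum_(j < n.+1) (n.+1 - j)%:R * y ^+ j
     + \sum_(j < n.+1) j%:R * (x ^+ n.+1 * y ^+ j).
  by rewrite -big_split /=; apply: eq_bigr => j _; rewrite mulrDl mulrA.
have -> : \sum_(j < n.+1) (n.+1 - j)%:R * y ^+ j
   = \sum_(j < n) (n - j)%:R * y ^+ j + \sum_(j < n.+1) y ^+ j.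
  rewrite (_ : \sum_(j < n) _ = \sum_(j < n.+1) (n - j)%:R * y ^+ j).
    rewrite -big_split /=; apply: eq_bigr => j _.
    by rewrite (subSn (valP j : (j <= n)%N)) -natr1 mulrDl mul1r.
  by rewrite big_ord_recr /= subnn mul0r addr0.
have -> : \sum_(j < n.+1) j%:R * (x ^+ n.+1 * y ^+ j)
   = \sum_(j < n) j%:R * (x ^+ n.+1 * y ^+ j.+1)
     + \sum_(j < n) x ^+ n.+1 * y ^+ j.+1.
  rewrite big_ord_recl mul0r add0r -big_split /=; apply: eq_bigr => j _.
  by rewrite /bump /= add1n -natr1 mulrDl mul1r.
have -> : \sum_(j < n) ((n - j)%:R + j%:R * x ^+ n) * y ^+ j
   = \sum_(j < n) (n - j)%:R * y ^+ j
     + \sum_(j < n) j%:R * (x ^+ n.+1 * y ^+ j.+1).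
  rewrite -big_split /=; apply: eq_bigr => j _; rewrite mulrDl -mulrA.
  by rewrite [x ^+ n.+1]exprS [y ^+ j.+1]exprS mulrACA xy1 mul1r.
by rewrite -!addrA; congr (_ + _); rewrite addrC -addrA.
Qed.

Lemma prim_root_orthogonality (F : fieldType) (n : nat) (w b : F) (i j : nat) :
  n.-primitive_root w -> b != 0 -> (i < n)%N -> (j < n)%N ->
  \sum_(l < n) (b * w ^+ l) ^+ j * (b * w ^+ l) ^- i = (i == j)%:R * n%:R.
Proof.
move=> wP b0 ltin ltjn.
have w0 : w != 0 by rewrite (prim_root_eq0 wP) -lt0n (prim_order_gt0 wP).
have bw0 l : b * w ^+ l != 0 by rewrite mulf_neq0 ?expf_neq0.
have [->|neij] := eqVneq i j.
  under eq_bigr do rewrite divff ?expf_neq0 //.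
  by rewrite sumr_const card_ord mul1r.
set q := w ^+ j / w ^+ i.
have qX l : q ^+ l = (w ^+ l) ^+ j / (w ^+ l) ^+ i.
  by rewrite expr_div_n -!exprM ![(l * _)%N]mulnC.
(* The summands form a geometric progression of ratio q, with q^n = 1. *)
have q1 : q != 1.
  apply: contra neij => /eqP q1; have : w ^+ i == w ^+ j.
    by rewrite -[w ^+ i]mul1r -q1 /q divfK ?expf_neq0.
  by rewrite (eq_prim_root_expr wP) !modn_small.
have -> : \sum_(l < n) (b * w ^+ l) ^+ j * (b * w ^+ l) ^- i
    = b ^+ j / b ^+ i * \sum_(l < n) q ^+ l.
  rewrite mulr_sumr; apply: eq_bigr => l _.
  rewrite qX (exprMn j) (exprMn i) invfM.
  exact: mulrACA.
rewrite mul0r; apply/eqP; rewrite mulf_eq0; apply/orP; right.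
have : (q - 1) * (\sum_(l < n) q ^+ l) = 0.
  by rewrite -subrX1 qX (prim_expr_order wP) !expr1n divr1 subrr.
by move/eqP; rewrite mulf_eq0 subr_eq0 (negPf q1).
Qed.

(** For [z] and [x] on the unit circle the two sums are conjugate, so that this
    is the Fejer kernel at x / z. Written with inverses instead of conjugates it
    makes sense over every field. *)
Definition fejer_weight (F : fieldType) (n : nat) (z x : F) : F :=
  (\sum_(j < n) (x / z) ^+ j) * (\sum_(j < n) (z / x) ^+ j) / n%:R.

(** On the nodes, [fejer_kernelE] turns the weight into a trigonometric
    polynomial in the inverse of the node, with explicit coefficients. For
    j < n orthogonality picks the coefficient of index j; for j = n the factor
    x^n = b^n is constant and the case j = 0 applies. *)
(** The right-hand side is linear in P, and for P = X^j it is z^j multiplied by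
    n - j + j (b / z)^n. *)
Lemma fejer_quadrature_monomial (F : fieldType) (n : nat) (w b z : F)
    (j : nat) :
  n.-primitive_root w -> b != 0 -> z != 0 -> (j <= n)%N ->
  \sum_(l < n) fejer_weight n z (b * w ^+ l) * (b * w ^+ l) ^+ j
  = ((n - j)%:R + j%:R * (b / z) ^+ n) * z ^+ j.
Proof.
move=> wP b0 z0 lejn.
have n0 := prim_root_natf_neq0 wP.
have ngt0 := prim_order_gt0 wP.
have w0 : w != 0 by rewrite (prim_root_eq0 wP) -lt0n.
have bw0 l : b * w ^+ l != 0 by rewrite mulf_neq0 ?expf_neq0.
have xn l : (b * w ^+ l) ^+ n = b ^+ n.
  by rewrite exprMn -exprM mulnC exprM (prim_expr_order wP) expr1n mulr1.
have weightE l : fejer_weight n z (b * w ^+ l) =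
    n%:R^-1 * \sum_(i < n) ((n - i)%:R + i%:R * (b / z) ^+ n) * z ^+ i
                           * (b * w ^+ l) ^- i.
  rewrite /fejer_weight mulrC -fejer_kernelE; last first.
    by rewrite mulrA divfK // divff.
  congr (_ * _); apply: eq_bigr => i _.
  by rewrite ![(_ / _) ^+ _]expr_div_n xn mulrA.
have small i : (i < n)%N ->
    \sum_(l < n) fejer_weight n z (b * w ^+ l) * (b * w ^+ l) ^+ i
    = ((n - i)%:R + i%:R * (b / z) ^+ n) * z ^+ i.
  move=> ltin.
  under eq_bigr do rewrite weightE -mulrA mulr_suml mulr_sumr.
  rewrite exchange_big /= (bigD1 (Ordinal ltin)) //= [X in _ + X]big1.
    rewrite addr0 -mulr_sumr.
    under eq_bigr do rewrite -mulrA [_ ^- i * _]mulrC.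
    rewrite -mulr_sumr prim_root_orthogonality // eqxx mul1r.
    by rewrite mulrC mulfK.
  move=> m nemi; rewrite -mulr_sumr.
  under eq_bigr do rewrite -mulrA [_ ^- m * _]mulrC.
  rewrite -mulr_sumr prim_root_orthogonality //.
  have -> : (m == i :> nat) = false by apply: negbTE.
  by rewrite mul0r !mulr0.
(* For j = n the power of the node is the constant b^n. *)
move: lejn; rewrite leq_eqVlt => /predU1P[->|]; last exact: small.
under eq_bigr => l _.
  rewrite xn -[fejer_weight _ _ _]mulr1 -(expr0 (b * w ^+ l)); over.
rewrite -mulr_suml small // subnn subn0 mul0r addr0 add0r expr0 mulr1.
by rewrite expr_div_n -mulrA divfK ?expf_neq0.
Qed.

Lemma horner_XM_deriv (A : comNzRingType) (n : nat) (P : {poly A}) (z : A) :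
  (size P <= n.+1)%N ->
  z * P^`().[z] = \sum_(j < n.+1) j%:R * P`_j * z ^+ j.
Proof.
move=> sP; rewrite big_ord_recl !mul0r add0r (@horner_coef_wide _ n).
  rewrite mulr_sumr; apply: eq_bigr => j _.
  by rewrite lift0 coef_deriv -mulr_natl exprS; ring.
by apply: leq_trans (size_poly _ _) _; case: (size P) sP.
Qed.

Lemma fejer_quadrature (F : fieldType) (n : nat) (w b z : F) (P : {poly F}) :
  n.-primitive_root w -> b != 0 -> z != 0 ->
  (size P <= n.+1)%N ->
  \sum_(l < n) fejer_weight n z (b * w ^+ l) * P.[b * w ^+ l]
  = n%:R * P.[z] - z * P^`().[z] + (b / z) ^+ n * (z * P^`().[z]).
Proof.
move=> wP b0 z0 sP.
rewrite (horner_XM_deriv _ sP) (horner_coef_wide _ sP).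
under eq_bigr do rewrite (horner_coef_wide _ sP) mulr_sumr.
rewrite exchange_big /= !mulr_sumr -sumrB -big_split /=.
apply: eq_bigr => j _; have lejn : (j <= n)%N by rewrite -ltnS.
under eq_bigr do rewrite mulrCA.
by rewrite -mulr_sumr fejer_quadrature_monomial // natrB //; ring.
Qed.

Lemma fejer_weight_ge0 (C : numClosedFieldType) (n : nat) (z x : C) :
  `|z| = 1 -> `|x| = 1 -> 0 <= fejer_weight n z x.
Proof.
move=> z1 x1; rewrite divr_ge0 ?ler0n //.
rewrite (_ : \sum_(j < n) (z / x) ^+ j = (\sum_(j < n) (x / z) ^+ j)^* ).
  by rewrite mul_conjC_ge0.
rewrite rmorph_sum; apply: eq_bigr => j _ /=; rewrite rmorphXn; congr (_ ^+ _).
rewrite /= rmorphM /= fmorphV /=.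
have conjE (y : C) : `|y| = 1 -> y^* = y^-1.
  move=> y1; have y0 : y != 0 by rewrite -normr_eq0 y1 oner_eq0.
  by apply: (mulfI y0); rewrite -normCK y1 expr1n divff.
by rewrite !conjE // invrK mulrC.
Qed.

(** The quadrature formula has nonnegative weights, and its case P = 1 shows
    that they add up to n. *)
Lemma polar_bound_on_nodes (C : numClosedFieldType) (n : nat) (w b z M : C)
    (P : {poly C}) :
  n.-primitive_root w -> `|b| = 1 -> `|z| = 1 -> (size P <= n.+1)%N ->
  (forall l, (l < n)%N -> `|P.[b * w ^+ l]| <= M) ->
  `|n%:R * P.[z] - z * P^`().[z] + (b / z) ^+ n * (z * P^`().[z])| <= n%:R * M.
Proof.
move=> wP b1 z1 sP PM.
have ngt0 := prim_order_gt0 wP.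
have b0 : b != 0 by rewrite -normr_eq0 b1 oner_eq0.
have z0 : z != 0 by rewrite -normr_eq0 z1 oner_eq0.
have w1 : `|w| = 1.
  apply/eqP; rewrite -(@pexpr_eq1 _ _ n) //.
  by rewrite -normrX (prim_expr_order wP) normr1.
have bw1 l : `|b * w ^+ l| = 1 by rewrite normrM normrX b1 w1 expr1n mul1r.
have sumw : \sum_(l < n) fejer_weight n z (b * w ^+ l) = n%:R.
  under eq_bigr => l _.
    rewrite -[fejer_weight _ _ _]mulr1 -(expr0 (b * w ^+ l)); over.
  rewrite fejer_quadrature_monomial //.
  by rewrite subn0 mul0r addr0 expr0 mulr1.
rewrite -(fejer_quadrature wP b0 z0 sP) -[in leRHS]sumw mulr_suml.
apply: le_trans (ler_norm_sum _ _ _) _; apply: ler_sum => l _.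
rewrite normrM ger0_norm ?fejer_weight_ge0 //.
by rewrite ler_wpM2l ?fejer_weight_ge0 ?PM.
Qed.

(** * Modulus and complex exponential *)

Local Open Scope complex_scope.

Section Modulus.
Variable R : realType.
Implicit Types x y z : R[i].

Lemma normC_modulus x : `|x| = (modulus x)%:C.
Proof. by []. Qed.

Lemma modulus_ge0 x : 0 <= modulus x.
Proof. by rewrite -ler0c -normC_modulus normr_ge0. Qed.

Lemma modulusM x y : modulus (x * y) = modulus x * modulus y.
Proof. by apply: (@complexI R); rewrite rmorphM -!normC_modulus normrM. Qed.

Lemma modulusX x n : modulus (x ^+ n) = modulus x ^+ n.
Proof. by apply: (@complexI R); rewrite rmorphXn -!normC_modulus normrX. Qed.

Lemma modulusV x : modulus x^-1 = (modulus x)^-1.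
Proof. by apply: (@complexI R); rewrite fmorphV -!normC_modulus normfV. Qed.

Lemma modulus_eq0 x : (modulus x == 0) = (x == 0).
Proof.
by rewrite -(normr_eq0 x) normC_modulus (fmorph_eq0 (real_complex R)).
Qed.

Lemma modulusN x : modulus (- x) = modulus x.
Proof. by apply: (@complexI R); rewrite -!normC_modulus normrN. Qed.

Lemma modulus_nat n : modulus (n%:R : R[i]) = n%:R.
Proof.
by apply: (@complexI R); rewrite rmorph_nat -!normC_modulus normr_nat.
Qed.

Lemma modulus1 : modulus (1 : R[i]) = 1.
Proof. exact: (modulus_nat 1%N). Qed.

Lemma ler_modulusD x y : modulus (x + y) <= modulus x + modulus y.
Proof. by rewrite -lecR rmorphD -!normC_modulus ler_normD. Qed.

Lemma ler_modulus_sum (I : finType) (F : I -> R[i]) :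
  modulus (\sum_i F i) <= \sum_i modulus (F i).
Proof.
elim/big_rec2: _ => [|i x y _ lexy].
  by rewrite le_eqVlt modulus_eq0 eqxx.
by apply: le_trans (ler_modulusD _ _) _; rewrite lerD2l.
Qed.

Lemma modulus_norm1 x : (modulus x = 1) <-> (`|x| = 1).
Proof.
rewrite normC_modulus; split=> [->//|]; exact: (@complexI R).
Qed.

Lemma sqr_modulus x : modulus x ^+ 2 = complex.Re x ^+ 2 + complex.Im x ^+ 2.
Proof. by case: x => a b; rewrite sqr_sqrtr // addr_ge0 ?sqr_ge0. Qed.

Lemma modulus_parallelogram x y :
  modulus (x + y) ^+ 2 + modulus (x - y) ^+ 2
  = 2 * (modulus x ^+ 2 + modulus y ^+ 2).
Proof. by rewrite !sqr_modulus !raddfD !raddfN /=; ring. Qed.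

Lemma modulus_real (t : R) : modulus t%:C = `|t|.
Proof. by rewrite /= expr0n addr0 sqrtr_sqr. Qed.

(** The factorization also holds at 0, where [u] is arbitrary; this avoids a
    separate treatment of gamma = 0. *)
Lemma modulus_polar_form x :
  exists2 u : R[i], modulus u = 1 & x = (modulus x)%:C * u.
Proof.
have [->|x0] := eqVneq x 0.
  exists 1; first exact: modulus1.
  by have /eqP -> : modulus (0 : R[i]) == 0; rewrite ?modulus_eq0 // mul0r.
have m0 : modulus x != 0 by rewrite modulus_eq0.
exists (x / (modulus x)%:C).
  by rewrite modulusM modulusV modulus_real ger0_norm ?modulus_ge0 // divff.
by rewrite mulrC divfK // (fmorph_eq0 (real_complex R)).
Qed.

Lemma cexpiD (s t : R) : cexpi (s + t) = cexpi s * cexpi t.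
Proof. by rewrite /cexpi sinD cosD [sin s * cos t + _]addrC. Qed.

Lemma cexpi0 : cexpi (0 : R) = 1.
Proof. by rewrite /cexpi cos0 sin0. Qed.

Lemma cexpiMn (t : R) n : cexpi (n%:R * t) = cexpi t ^+ n.
Proof.
elim: n => [|n IHn]; first by rewrite mul0r cexpi0.
by rewrite exprS -IHn -cexpiD -natr1; congr cexpi; ring.
Qed.

Lemma cexpiDpi (t : R) : cexpi (t + pi) = - cexpi t.
Proof. by rewrite /cexpi cosDpi sinDpi. Qed.

Lemma modulus_cexpi (t : R) : modulus (cexpi t) = 1.
Proof. by rewrite /= cos2Dsin2 sqrtr1. Qed.

Lemma cexpi2pi : cexpi (2 * pi : R) = 1.
Proof. by rewrite mulr_natl /cexpi cos2pi sin2pi. Qed.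

(** A power e^{2ih} with 0 < h < pi differs from 1 because
    cos (2h) = 1 - 2 sin^2 h. *)
Lemma prim_root_cexpi n : (0 < n)%N ->
  n.-primitive_root (cexpi (2 * pi / n%:R : R)).
Proof.
move=> n0; have nR0 : (n%:R : R) != 0 by rewrite pnatr_eq0 -lt0n.
apply/andP; split=> //; apply/forallP => i; apply/eqP.
rewrite unity_rootE -cexpiMn.
have lein : (i.+1 <= n)%N by [].
have [/eqP ->|neq] := boolP (i.+1 == n).
  by rewrite mulrC divfK // cexpi2pi eqxx.
apply: negbTE.
set h := i.+1%:R * pi / n%:R : R.
have -> : i.+1%:R * (2 * pi / n%:R) = h *+ 2.
  by rewrite /h -mulr_natl; ring.
have h0 : 0 < h by rewrite divr_gt0 ?mulr_gt0 ?pi_gt0 ?ltr0n.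
have hpi : h < pi.
  rewrite ltr_pdivrMr ?ltr0n // mulrC ltr_pM2l ?pi_gt0 // ltr_nat.
  by rewrite ltn_neqAle neq.
rewrite /cexpi cos_mulr2n eq_complex /= negb_and; apply/orP; left.
have := @sin_gt0_pi _ h; rewrite h0 hpi => /(_ isT) sh.
have := cos2Dsin2 h; move: (cos h) (sin h) sh => c s s0 cs.
by apply/eqP; nra.
Qed.

End Modulus.

(** * Bounds by the maxima on the nodes and on the circle *)

Section MaximumBounds.
Variable R : realType.
Implicit Types (z : R[i]) (P : {poly R[i]}).

(** The nodes are numbered from 1, the powers of the primitive root from 0; the
    extra factor e^{2 i pi / n} absorbs the shift. *)
Lemma cexpi_node n (alpha : R) l : (0 < n)%N ->
  cexpi ((alpha + 2 * l.+1%:R * pi) / n%:R)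
  = cexpi ((alpha + 2 * pi) / n%:R) * cexpi (2 * pi / n%:R) ^+ l.
Proof.
move=> n0; rewrite -cexpiMn -cexpiD -natr1; congr cexpi.
by ring.
Qed.

Lemma ler_max_nodes n (P : {poly R[i]}) alpha l :
  size P = n.+1 -> (l < n)%N ->
  modulus P.[cexpi ((alpha + 2 * l.+1%:R * pi) / n%:R)] <= max_nodes P alpha.
Proof.
move=> sP ltln; rewrite /max_nodes sP /=.
apply: (@le_bigmax_seq _ _ _ _ 0 l.+1 xpredT
  (fun l => modulus P.[cexpi ((alpha + 2 * l%:R * pi) / n%:R)])) => //.
by rewrite mem_index_iota.
Qed.

(** The supremum is finite: on the unit circle the sum of the moduli of the
    coefficients is an upper bound. *)
Lemma ler_max_circle (P : {poly R[i]}) z :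
  modulus z = 1 -> modulus P.[z] <= max_circle P.
Proof.
move=> z1; apply: ub_le_sup; last by exists z.
exists (\sum_(i < size P) modulus P`_i) => _ [w w1 <-].
rewrite horner_coef.
apply: le_trans (ler_modulus_sum _) _; apply: ler_sum => i _.
by rewrite modulusM modulusX w1 expr1n mulr1.
Qed.

Lemma polar_bound_modulus (n : nat) (w b z : R[i]) (M : R) (P : {poly R[i]}) :
  n.-primitive_root w -> modulus b = 1 -> modulus z = 1 ->
  (size P <= n.+1)%N ->
  (forall l, (l < n)%N -> modulus P.[b * w ^+ l] <= M) ->
  modulus (n%:R * P.[z] - z * P^`().[z] + (b / z) ^+ n * (z * P^`().[z]))
    <= n%:R * M.
Proof.
move=> wP /modulus_norm1 b1 /modulus_norm1 z1 sP PM.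
rewrite -lecR rmorphM rmorph_nat -normC_modulus.
apply: polar_bound_on_nodes wP b1 z1 sP _ => l ltln.
by rewrite normC_modulus lecR PM.
Qed.

Lemma polar_bound_max_nodes (n : nat) (z : R[i]) (alpha : R) (P : {poly R[i]}) :
  (0 < n)%N -> size P = n.+1 -> modulus z = 1 ->
  modulus (n%:R * P.[z] - z * P^`().[z]
           + cexpi alpha / z ^+ n * (z * P^`().[z]))
    <= n%:R * max_nodes P alpha.
Proof.
move=> n0 sP z1.
have := @polar_bound_modulus n (cexpi (2 * pi / n%:R))
  (cexpi ((alpha + 2 * pi) / n%:R)) z (max_nodes P alpha) P.
rewrite expr_div_n.
have -> : cexpi ((alpha + 2 * pi) / n%:R) ^+ n = cexpi alpha.
  rewrite -cexpiMn mulrC divfK ?pnatr_eq0 -?lt0n //.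
  by rewrite cexpiD cexpi2pi mulr1.
apply => //; rewrite ?sP //.
- exact: prim_root_cexpi.
- exact: modulus_cexpi.
- by move=> l ltln; rewrite -cexpi_node // ler_max_nodes.
Qed.

(** Passing from alpha to alpha + pi changes the sign of the unimodular factor
    in [polar_bound_max_nodes], so the two bounds combine by the parallelogram
    law. *)
Lemma sqr_deriv_le_max_nodes (n : nat) (z : R[i]) (alpha : R)
    (P : {poly R[i]}) :
  (0 < n)%N -> size P = n.+1 -> modulus z = 1 ->
  modulus (n%:R * P.[z] - z * P^`().[z]) ^+ 2 + modulus (z * P^`().[z]) ^+ 2
  <= n%:R ^+ 2 / 2
     * (max_nodes P alpha ^+ 2 + max_nodes P (alpha + pi) ^+ 2).
Proof.
move=> n0 sP z1.
have := polar_bound_max_nodes alpha n0 sP z1.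
have := polar_bound_max_nodes (alpha + pi) n0 sP z1.
rewrite cexpiDpi !mulNr.
set A := n%:R * _ - _; set B := z * _; set u := cexpi alpha / _.
have u1 : modulus u = 1.
  by rewrite modulusM modulusV modulusX z1 expr1n invr1 modulus_cexpi mulr1.
have := modulus_parallelogram A (u * B).
rewrite [modulus (u * B)]modulusM u1 mul1r.
have := modulus_ge0 (A - u * B); have := modulus_ge0 (A + u * B).
move: (modulus (A + u * B)) (modulus (A - u * B)) => x y x0 y0 E ley lex.
have := ler_pM x0 x0 lex lex; have := ler_pM y0 y0 ley ley.
nra.
Qed.

(** Every unimodular [u] is of the form b^n / z^n, so there are n nodes for
    which the quadrature formula produces the factor [u]. *)
Lemma polar_bound_max_circle (n : nat) (z u : R[i]) (P : {poly R[i]}) :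
  (0 < n)%N -> size P = n.+1 -> modulus z = 1 -> modulus u = 1 ->
  modulus (n%:R * P.[z] - z * P^`().[z] + u * (z * P^`().[z]))
    <= n%:R * max_circle P.
Proof.
move=> n0 sP z1 u1; set b := (n.-root u)%C * z.
have zn0 : z ^+ n != 0 by rewrite -modulus_eq0 modulusX z1 expr1n oner_eq0.
have bn : (b / z) ^+ n = u by rewrite expr_div_n exprMn rootCK // mulfK.
have z0 : z != 0 by rewrite -modulus_eq0 z1 oner_eq0.
have b1 : modulus b = 1.
  have /(congr1 (@modulus R))/eqP := bn; rewrite modulusX u1.
  by rewrite pexpr_eq1 ?modulus_ge0 // modulusM modulusV z1 invr1 mulr1 => /eqP.
have := @polar_bound_modulus n (cexpi (2 * pi / n%:R)) b z (max_circle P) P.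
rewrite bn; apply => //; rewrite ?sP //; first exact: prim_root_cexpi.
move=> l _; apply: ler_max_circle.
by rewrite modulusM modulusX b1 modulus_cexpi expr1n mulr1.
Qed.

End MaximumBounds.

(** * The logarithmic derivative on the unit circle *)

Section LogDeriv.
Variable R : realType.
Implicit Types (x y z w : R[i]) (p q : {poly R[i]}).

(** This is the real part of z P'(z) / P(z), the derivative of ln |P| along the
    ray through z when |z| = 1. *)
Definition re_log_deriv z p : R := complex.Re (z * p^`().[z] / p.[z]).

Lemma re_log_derivM z p q : p.[z] != 0 -> q.[z] != 0 ->
  re_log_deriv z (p * q) = re_log_deriv z p + re_log_deriv z q.
Proof.
move=> p0 q0; rewrite /re_log_deriv -raddfD /=; congr complex.Re.
by rewrite derivM hornerD !hornerM; field; rewrite p0 q0.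
Qed.

Lemma re_log_deriv1 z : re_log_deriv z 1 = 0.
Proof. by rewrite /re_log_deriv -polyC1 derivC horner0 mulr0 mul0r. Qed.

Lemma re_log_derivX z p n : p.[z] != 0 ->
  re_log_deriv z (p ^+ n) = n%:R * re_log_deriv z p.
Proof.
move=> p0; elim: n => [|n IHn]; first by rewrite re_log_deriv1 mul0r.
by rewrite exprS re_log_derivM ?horner_exp ?expf_neq0 // IHn -natr1; ring.
Qed.

Lemma re_log_derivZ z a p :
  a != 0 -> re_log_deriv z (a *: p) = re_log_deriv z p.
Proof.
move=> a0; rewrite /re_log_deriv derivZ !hornerZ; congr complex.Re.
by rewrite mulrCA -mulf_div divff ?mul1r.
Qed.

Lemma re_log_deriv_XsubC z w :
  re_log_deriv z ('X - w%:P) = complex.Re (z / (z - w)).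
Proof.
by rewrite /re_log_deriv derivXsubC hornerXsubC -polyC1 hornerC mulr1.
Qed.

Lemma re_log_deriv_prod z (r : seq R[i]) : z \notin r ->
  re_log_deriv z (\prod_(w <- r) ('X - w%:P))
  = \sum_(w <- r) complex.Re (z / (z - w)).
Proof.
elim: r => [|w r IHr]; first by rewrite !big_nil re_log_deriv1.
rewrite inE negb_or => /andP[zw zr]; rewrite !big_cons re_log_derivM.
- by rewrite IHr // re_log_deriv_XsubC.
- by rewrite hornerXsubC subr_eq0.
- by rewrite -rootE root_prod_XsubC.
Qed.

Lemma Re_div x y : complex.Re (x / y)
  = (complex.Re x * complex.Re y + complex.Im x * complex.Im y) / modulus y ^+ 2.
Proof. by rewrite sqr_modulus; case: x y => [a b] [c d] /=; ring. Qed.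

(** The number [c] is the scalar product of [z] and [w]; its bounds are the
    Cauchy-Schwarz inequality. *)
Lemma unit_circle_split z w : modulus z = 1 -> exists2 c : R,
  - modulus w <= c <= modulus w &
  modulus (z - w) ^+ 2 = 1 - 2 * c + modulus w ^+ 2
  /\ complex.Re (z / (z - w)) = (1 - c) / modulus (z - w) ^+ 2.
Proof.
move=> z1; rewrite Re_div !sqr_modulus !raddfB /=.
have := sqr_modulus z; rewrite z1 expr1n.
have := sqr_modulus w; have := modulus_ge0 w.
move: (modulus w) => m; case: z z1 => a b _; case: w => x y /= m0 mE zE.
have cs : (a * x + b * y) ^+ 2 <= m ^+ 2.
  rewrite mE -[leRHS]mul1r zE; have := sqr_ge0 (a * y - b * x); nra.
exists (a * x + b * y).
  rewrite -ler_norml -(ger0_norm m0) -ler_sqr ?nnegrE ?normr_ge0 //.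
  by rewrite !real_normK ?num_real.
by split; [nra | congr (_ / _); nra].
Qed.

(** After clearing denominators this is (1 - m) (c + m) >= 0, where m = |w| and
    c >= - m is the scalar product of [z] and [w]. *)
Lemma re_unit_div_inside z w : modulus z = 1 -> modulus w <= 1 -> z != w ->
  1 / (1 + modulus w) <= complex.Re (z / (z - w)).
Proof.
move=> z1 w1 zw; have [c /andP[cl cu] [dE ->]] := unit_circle_split w z1.
have d0 : 0 < modulus (z - w) ^+ 2.
  by rewrite exprn_gt0 // lt_neqAle modulus_ge0 eq_sym modulus_eq0 subr_eq0 zw.
have := modulus_ge0 w; move: (modulus w) w1 cl cu dE d0 => m w1 cl cu dE d0 m0.
rewrite ler_pdivrMr; last by lra.
by rewrite mulrAC ler_pdivlMr // mul1r dE; nra.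
Qed.

(** After clearing denominators this is (1 + m) (m - c) >= 0, where m = |w| and
    c <= m is the scalar product of [z] and [w]. *)
Lemma re_unit_div_outside z w : modulus z = 1 -> 1 < modulus w ->
  - (1 / (modulus w - 1)) <= complex.Re (z / (z - w)).
Proof.
move=> z1 w1; have [c /andP[cl cu] [dE ->]] := unit_circle_split w z1.
have zw : z != w by apply: contraTneq w1 => <-; rewrite z1 ltxx.
have d0 : 0 < modulus (z - w) ^+ 2.
  by rewrite exprn_gt0 // lt_neqAle modulus_ge0 eq_sym modulus_eq0 subr_eq0 zw.
move: (modulus w) w1 cl cu dE d0 => m w1 cl cu dE d0.
rewrite -mulNr ler_pdivrMr; last by lra.
by rewrite mulrAC ler_pdivlMr // dE; nra.
Qed.

End LogDeriv.

(** * Two inequalities on finite families of reals *)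

(** With f t = (1 - t) / (1 + t), the difference f t + f q - f (t q) equals
    (1 - t q) (1 - t) (1 - q) / ((1 + t) (1 + q) (1 + t q)), which is
    nonnegative on [0, 1]. The bounds on the product keep the induction going. *)
Lemma cayley_prod_le (R : realFieldType) (r : seq R) :
  all (fun t => 0 <= t <= 1) r ->
  0 <= \prod_(t <- r) t <= 1 /\
  (1 - \prod_(t <- r) t) / (1 + \prod_(t <- r) t)
    <= \sum_(t <- r) (1 - t) / (1 + t).
Proof.
elim: r => [_|t r IHr /= /andP[/andP[t0 t1] /IHr]].
  by rewrite !big_nil subrr mul0r ler01 lexx.
rewrite !big_cons; move: (\prod_(t <- r) t) (\sum_(t <- r) _) => q S.
move=> [/andP[q0 q1] leS]; split; first by apply/andP; split; nra.
apply: le_trans (_ : _ <= (1 - t) / (1 + t) + (1 - q) / (1 + q)) _; last first.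
  by rewrite lerD2l.
rewrite -subr_ge0.
have -> : (1 - t) / (1 + t) + (1 - q) / (1 + q) - (1 - t * q) / (1 + t * q)
  = (1 - t * q) * ((1 - t) * (1 - q)) / ((1 + t) * (1 + q) * (1 + t * q)).
  by field; rewrite !gt_eqF //; nra.
by rewrite divr_ge0 ?mulr_ge0 //; nra.
Qed.

(** Each term exceeds 1 / (1 + k) by at least k / (1 + k) f (t / k), with
    f x = (1 - x) / (1 + x); this is where k <= 1 enters. The values of [f] are
    then summed with [cayley_prod_le]. *)
Lemma sum_inv_onep_ge (R : realFieldType) (k : R) (r : seq R) :
  0 < k -> k <= 1 -> all (fun t => 0 <= t <= k) r ->
  (size r)%:R / (1 + k) + k / (1 + k)
      * ((1 - \prod_(t <- r) (t / k)) / (1 + \prod_(t <- r) (t / k)))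
    <= \sum_(t <- r) 1 / (1 + t).
Proof.
move=> k0 k1 rk; set q := \prod_(t <- r) _.
have /cayley_prod_le[_] : all (fun t => 0 <= t <= 1) [seq t / k | t <- r].
  rewrite all_map; apply: sub_all rk => t /= /andP[t0 tk].
  by rewrite divr_ge0 ?(ltW k0) // ler_pdivrMr // mul1r.
rewrite !big_map -/q => leq.
apply: le_trans (_ : _ <= (size r)%:R / (1 + k)
    + k / (1 + k) * \sum_(t <- r) (1 - t / k) / (1 + t / k)) _.
  by rewrite lerD2l ler_wpM2l // divr_ge0; lra.
have -> : (size r)%:R / (1 + k) = \sum_(t <- r) (1 + k)^-1.
  by rewrite big_const_seq count_predT iter_addr_0 mulr_natl.
rewrite mulr_sumr -big_split /= big_seq [leRHS]big_seq.
apply: ler_sum => t /(allP rk)/andP[t0 tk].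
rewrite -subr_ge0.
have -> : 1 / (1 + t) - ((1 + k)^-1 + k / (1 + k) * ((1 - t / k) / (1 + t / k)))
  = (1 - k) * t * (k - t) / ((1 + k) * (1 + t) * (k + t)).
  by field; rewrite !gt_eqF //; lra.
by rewrite divr_ge0 ?mulr_ge0 //; lra.
Qed.

(** * Zeros and the logarithmic derivative *)

Section Zeros.
Variable R : realType.
Implicit Types (z w : R[i]) (p : {poly R[i]}).

(** The modulus of p(0) / p_m is the product of the moduli of the roots, which
    identifies the quotient of coefficients with (1 - q) / (1 + q), where q is
    the product of the |w| / k. *)
Lemma re_log_deriv_disk m (k : R) z p :
  0 < k -> k <= 1 -> modulus z = 1 -> size p = m.+1 -> p.[z] != 0 ->
  (forall w, root p w -> modulus w <= k) ->
  m%:R / (1 + k) + k / (1 + k)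
      * ((modulus p`_m * k ^+ m - modulus p`_0)
         / (modulus p`_m * k ^+ m + modulus p`_0))
    <= re_log_deriv z p.
Proof.
move=> k0 k1 z1 sp pz0 rootk.
set a := _ * k ^+ m; set b := modulus p`_0.
have [r pE] := closed_field_poly_normal p.
have p0 : p != 0 by rewrite -size_poly_gt0 sp.
have l0 : lead_coef p != 0 by rewrite lead_coef_eq0.
have lE : lead_coef p = p`_m by rewrite /lead_coef sp.
have sr : size r = m.
  by move: sp; rewrite pE size_scale // size_prod_XsubC => -[].
have rP w : (w \in r) = root p w by rewrite pE rootZ // root_prod_XsubC.
have zr : z \notin r by rewrite rP.
rewrite pE re_log_derivZ // re_log_deriv_prod //.
have := @sum_inv_onep_ge R k [seq modulus w | w <- r] k0 k1 _.
rewrite size_map sr !big_map; set q := \prod_(w <- r) _.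
have b_q : b = a * q.
  rewrite /b -horner_coef0 {1}pE hornerZ modulusM /a -lE -mulrA; congr (_ * _).
  rewrite /q -sr; elim: (r) => [|w s IHs].
    by rewrite !big_nil -polyC1 hornerC modulus1 mulr1.
  rewrite !big_cons hornerM modulusM IHs hornerXsubC sub0r modulusN exprS /=.
  by field; rewrite gt_eqF.
have a0 : 0 < a.
  by rewrite mulr_gt0 ?exprn_gt0 // lt_neqAle modulus_ge0 eq_sym modulus_eq0 -lE l0.
have q0 : 0 <= q.
  by rewrite prodr_ge0 // => w _; rewrite divr_ge0 ?modulus_ge0 // ltW.
have -> : (a - b) / (a + b) = (1 - q) / (1 + q).
  by rewrite b_q; field; rewrite !gt_eqF //; nra.
move=> leS; apply: le_trans (leS _) _.
  by rewrite all_map; apply/allP => w /=; rewrite rP modulus_ge0 => /rootk.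
rewrite big_seq [leRHS]big_seq; apply: ler_sum => w wr.
apply: re_unit_div_inside => //; last by apply: contraNneq zr => ->.
by apply: le_trans k1; apply: rootk; rewrite -rP.
Qed.

(** The zero at [z0] contributes at least - s / (|z0| - 1), and the cofactor of
    degree n - s has all its zeros in the disk of radius [k]: a zero outside
    would be [z0] again and raise its multiplicity. *)
Lemma re_log_deriv_ge (n s : nat) (k : R) z0 (c : nat -> R[i]) p z :
  0 < k -> k <= 1 -> (s < n)%N -> 1 < modulus z0 ->
  zeros_in_disk_but_one n s k z0 c p -> modulus z = 1 -> p.[z] != 0 ->
  n%:R - zero_excess n s k z0 c <= re_log_deriv z p.
Proof.
move=> k0 k1 ltsn z01 [pE c0 sp zk mup_s] z1 pz0.
set g := \sum_(0 <= v < _) _ in pE.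
have p0 : p != 0 by rewrite -size_poly_gt0 sp.
have g_poly : g = \poly_(v < (n - s).+1) c v.
  by rewrite poly_def /g big_mkord.
have X0 : ('X - z0%:P) ^+ s != 0 by rewrite expf_neq0 ?polyXsubC_eq0.
have g0 : g != 0 by apply: contraNneq p0 => g0; rewrite pE g0 mulr0.
have sg : size g = (n - s).+1.
  have := sp; rewrite pE size_mul // size_exp_XsubC /= => sE.
  by rewrite -subSn ?(ltnW ltsn) // -sE addKn.
have gz0 : ~~ root g z0.
  apply: contra_eqN mup_s => gr; rewrite pE mupM // mup_XsubCX eqxx.
  by rewrite -[X in _ != X]addn0 eqn_add2l -lt0n -XsubC_dvd // dvdp_XsubCl.
have [Xz gz] : ('X - z0%:P).[z] != 0 /\ g.[z] != 0.
  move: pz0; rewrite pE hornerM horner_exp mulf_eq0 negb_or => /andP[Xz ->].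
  split=> //; apply: contraNneq gz0 => X_z.
  have /eqP : z - z0 = 0 by rewrite -X_z hornerXsubC.
  by rewrite subr_eq0 => /eqP zz0; move: z01; rewrite -zz0 z1 ltxx.
rewrite pE re_log_derivM ?horner_exp ?expf_neq0 // re_log_derivX //.
rewrite re_log_deriv_XsubC.
have out := re_unit_div_outside z1 z01.
have := @re_log_deriv_disk (n - s) k z g k0 k1 z1 sg gz _.
rewrite g_poly !coef_poly ltnSn /= -g_poly => ins.
rewrite /zero_excess.
set F := (_ - _) / (_ + _) in ins *.
have nE : n%:R = s%:R + (n - s)%:R :> R by rewrite -natrD subnKC // ltnW.
apply: le_trans (_ : _ <= s%:R * - (1 / (modulus z0 - 1))
    + ((n - s)%:R / (1 + k) + k / (1 + k) * F)) _.
  rewrite le_eqVlt; apply/orP; left; apply/eqP; rewrite {1}nE.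
  by field; rewrite !gt_eqF //; lra.
apply: lerD; first by rewrite ler_wpM2l.
apply: ins => w gw; rewrite leNgt; apply/negP => kw.
have ww : w = z0 by apply: zk => //; rewrite pE rootM gw orbT.
by move: gz0; rewrite -ww gw.
Qed.

End Zeros.

(** * The upper bound for the polar derivative *)

Section Polar.
Variable R : realType.
Implicit Types (x y z w gamma : R[i]) (P : {poly R[i]}).

Lemma horner_polar_deriv n gamma P z : size P = n.+1 ->
  (polar_deriv gamma P).[z] = n%:R * P.[z] + (gamma - z) * P^`().[z].
Proof.
by move=> sP; rewrite /polar_deriv sP hornerD hornerZ hornerM !hornerE.
Qed.

(** Write gamma = |gamma| u. Then D_gamma P(z) is (1 - |gamma|) times
    n P - z P' plus |gamma| times n P - z P' + u P', and the second
    expression is bounded by [polar_bound_max_circle]. *)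
Lemma polar_deriv_convex_bound n gamma P z :
  (0 < n)%N -> size P = n.+1 -> modulus gamma <= 1 -> modulus z = 1 ->
  modulus (polar_deriv gamma P).[z]
  <= (1 - modulus gamma) * modulus (n%:R * P.[z] - z * P^`().[z])
     + modulus gamma * (n%:R * max_circle P).
Proof.
move=> n0 sP g1 z1; have z0 : z != 0 by rewrite -modulus_eq0 z1 oner_eq0.
have [u u1 gE] := modulus_polar_form gamma.
have uz1 : modulus (u / z) = 1 by rewrite modulusM modulusV u1 z1 invr1 mulr1.
have -> : (polar_deriv gamma P).[z]
  = (1 - modulus gamma)%:C * (n%:R * P.[z] - z * P^`().[z])
    + (modulus gamma)%:C
      * (n%:R * P.[z] - z * P^`().[z] + u / z * (z * P^`().[z])).
  have -> : (1 - modulus gamma)%:C = 1 - (modulus gamma)%:C by rewrite rmorphB.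
  rewrite (horner_polar_deriv _ _ sP) [in LHS]gE.
  by move: (modulus gamma)%:C => g; field.
apply: le_trans (ler_modulusD _ _) _; rewrite !modulusM !modulus_real.
rewrite !ger0_norm ?modulus_ge0 ?subr_ge0 // lerD2l ler_wpM2l ?modulus_ge0 //.
exact: polar_bound_max_circle.
Qed.

(** Dividing by P(z), this is |n - q|^2 = |q|^2 + n (n - 2 Re q) for
    q = z P' / P. *)
Lemma sqr_modulus_reversed_deriv n P z : P.[z] != 0 ->
  modulus (n%:R * P.[z] - z * P^`().[z]) ^+ 2
  = modulus (z * P^`().[z]) ^+ 2
    + n%:R * (n%:R - 2 * re_log_deriv z P) * modulus P.[z] ^+ 2.
Proof.
move=> Pz0; rewrite /re_log_deriv.
rewrite -[z * P^`().[z]](divfK Pz0) mulfK //; move: (_ / P.[z]) => q.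
rewrite -mulrBl !modulusM !exprMn -mulrDl; congr (_ * _).
have -> : n%:R = n%:R%:C :> R[i] by rewrite rmorph_nat.
by rewrite !sqr_modulus !raddfB /=; ring.
Qed.

(** Adding the bound for the sum of the squares of |n P - z P'| and |z P'| to
    the bound for their difference given by the location of the zeros eliminates
    |z P'|. *)
Lemma reversed_deriv_bound (k : R) (n s : nat) z0 (c : nat -> R[i]) P z
    (alpha : R) :
  0 < k -> k <= 1 -> (s < n)%N -> 1 < modulus z0 ->
  zeros_in_disk_but_one n s k z0 c P -> modulus z = 1 ->
  modulus (n%:R * P.[z] - z * P^`().[z])
  <= n%:R / 2
     * Num.sqrt (max_nodes P alpha ^+ 2 + max_nodes P (alpha + pi) ^+ 2
                 - 2 * (1 - 2 / n%:R * zero_excess n s k z0 c)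
                   * modulus P.[z] ^+ 2).
Proof.
move=> k0 k1 ltsn z01 zP z1; have sP : size P = n.+1 by case: zP.
have n0 : (0 < n)%N by apply: leq_ltn_trans ltsn.
have n0R : 0 < n%:R :> R by rewrite ltr0n.
have square_sum := sqr_deriv_le_max_nodes alpha n0 sP z1.
have square_diff : modulus (n%:R * P.[z] - z * P^`().[z]) ^+ 2
    <= modulus (z * P^`().[z]) ^+ 2
       + n%:R * (2 * zero_excess n s k z0 c - n%:R) * modulus P.[z] ^+ 2.
  (* A zero of P on the unit circle is possible when k = 1. *)
  have [Pz|Pz0] := eqVneq P.[z] 0.
    rewrite Pz mulr0 sub0r modulusN lerDl.
    have /eqP -> : modulus (0 : R[i]) == 0 by rewrite modulus_eq0.
    by rewrite expr0n mulr0.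
  rewrite sqr_modulus_reversed_deriv // lerD2l ler_wpM2r ?sqr_ge0 //.
  rewrite ler_wpM2l ?ler0n //.
  by have := re_log_deriv_ge k0 k1 ltsn z01 zP z1 Pz0; lra.
rewrite -[leLHS]ger0_norm ?modulus_ge0 // -sqrtr_sqr.
rewrite -[n%:R / 2]ger0_norm ?divr_ge0 ?ler0n // -sqrtr_sqr.
rewrite -sqrtrM ?sqr_ge0 //; apply: ler_wsqrtr.
move: square_sum square_diff.
set A2 := modulus _ ^+ 2; set B2 := modulus _ ^+ 2; set M2 := _ + _ ^+ 2.
set E := zero_excess _ _ _ _ _; set p2 := modulus _ ^+ 2 => sum diff.
have -> : (n%:R / 2) ^+ 2 * (M2 - 2 * (1 - 2 / n%:R * E) * p2)
   = (n%:R ^+ 2 / 2 * M2 - n%:R * (n%:R - 2 * E) * p2) / 2.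
  by field; rewrite gt_eqF.
by lra.
Qed.

Lemma polar_deriv_bound (k : R) (n s : nat) z0 (c : nat -> R[i]) P
    gamma (alpha : R) z :
  0 < k -> k <= 1 -> (s < n)%N -> 1 < modulus z0 ->
  zeros_in_disk_but_one n s k z0 c P ->
  modulus gamma <= 1 -> modulus z = 1 ->
  modulus (polar_deriv gamma P).[z]
    <= n%:R / 2 * polar_bracket n s k z0 c P gamma alpha z.
Proof.
move=> k0 k1 ltsn z01 zP g1 z1; have sP : size P = n.+1 by case: zP.
have n0 : (0 < n)%N by apply: leq_ltn_trans ltsn.
apply: le_trans (polar_deriv_convex_bound n0 sP g1 z1) _.
have g1' : 0 <= 1 - modulus gamma by rewrite subr_ge0.
have := ler_wpM2l g1' (reversed_deriv_bound alpha k0 k1 ltsn z01 zP z1).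
rewrite /polar_bracket; move: (Num.sqrt _) => S; lra.
Qed.

End Polar.

(** * The extremal polynomial X^n + 1 *)

Section Extremal.
Variable R : realType.
Implicit Types (z gamma : R[i]).

Lemma horner_XnD1 n z : ('X^n + 1 : {poly R[i]}).[z] = z ^+ n + 1.
Proof. by rewrite hornerD hornerXn -polyC1 hornerC. Qed.

Lemma size_XnD1 n : (0 < n)%N -> size ('X^n + 1 : {poly R[i]}) = n.+1.
Proof. by move=> n0; rewrite -polyC1 size_XnaddC. Qed.

Lemma coef_XnD1 n : (0 < n)%N ->
  ('X^n + 1 : {poly R[i]})`_n = 1 /\ ('X^n + 1 : {poly R[i]})`_0 = 1.
Proof.
move=> n0; rewrite !coefD !coefXn !coef1 !eqxx (ltn_eqF n0) (gtn_eqF n0).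
by rewrite addr0 add0r.
Qed.

Lemma zeros_in_disk_XnD1 n z0 : (0 < n)%N -> 1 < modulus z0 ->
  zeros_in_disk_but_one n 0 1 z0 (fun v => ('X^n + 1 : {poly R[i]})`_v)
    ('X^n + 1).
Proof.
move=> n0 z01; have noroot z : 1 < modulus z -> ~~ root ('X^n + 1) z.
  move=> z1; apply/negP => /rootP; rewrite horner_XnD1 => /eqP.
  rewrite addr_eq0 => /eqP/(congr1 (@modulus R)).
  rewrite modulusX modulusN modulus1 => /eqP; rewrite gt_eqF //.
  by rewrite exprn_egt1 // -lt0n.
split=> //.
- rewrite expr0 mul1r subn0 big_mkord -poly_def -(size_XnD1 n0).
  by rewrite coefK.
- by have [_ ->] := coef_XnD1 n0; rewrite oner_eq0.
- exact: size_XnD1.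
- by move=> z /noroot/negP nz /nz.
- by rewrite mupNroot ?noroot.
Qed.

Lemma max_circle_XnD1 n : max_circle ('X^n + 1 : {poly R[i]}) = 2.
Proof.
apply/eqP; rewrite eq_le; apply/andP; split.
  apply: ge_sup.
    exists (modulus ('X^n + 1 : {poly R[i]}).[1]).
    by exists 1 => //; exact: modulus1.
  move=> _ [w w1 <-]; rewrite horner_XnD1.
  apply: le_trans (ler_modulusD _ _) _.
  by rewrite modulusX w1 expr1n modulus1.
have := @ler_max_circle R ('X^n + 1) 1 (modulus1 R).
by rewrite horner_XnD1 expr1n -(natrD _ 1 1) modulus_nat.
Qed.

(** X^n + 1 takes the same value 1 + e^{i alpha} at all nodes. *)
Lemma max_nodes_XnD1 n (alpha : R) : (0 < n)%N ->
  max_nodes ('X^n + 1 : {poly R[i]}) alpha = modulus (1 + cexpi alpha).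
Proof.
move=> n0.
have node l :
    modulus ('X^n + 1 : {poly R[i]}).[cexpi ((alpha + 2 * l%:R * pi) / n%:R)]
    = modulus (1 + cexpi alpha).
  rewrite horner_XnD1 -cexpiMn mulrC divfK ?pnatr_eq0 -?lt0n // addrC.
  by rewrite cexpiD [2 * _]mulrC -mulrA cexpiMn cexpi2pi expr1n mulr1.
apply/eqP; rewrite eq_le; apply/andP; split.
  rewrite /max_nodes size_XnD1 //; apply: bigmax_le => [|l _].
    exact: modulus_ge0.
  by rewrite node.
by rewrite -(node 1%N); apply: ler_max_nodes; rewrite ?size_XnD1.
Qed.

Lemma zero_excess_XnD1 n z0 : (0 < n)%N ->
  zero_excess n 0 1 z0 (fun v => ('X^n + 1 : {poly R[i]})`_v) = n%:R / 2.
Proof.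
move=> n0; rewrite /zero_excess subn0; have [-> ->] := coef_XnD1 n0.
by rewrite modulus1 expr1n !mul0r; field.
Qed.

Lemma polar_bracket_XnD1 n z0 gamma (alpha : R) z : (0 < n)%N ->
  polar_bracket n 0 1 z0 (fun v => ('X^n + 1 : {poly R[i]})`_v)
    ('X^n + 1) gamma alpha z = 2 * (1 + modulus gamma).
Proof.
move=> n0; rewrite /polar_bracket zero_excess_XnD1 // max_circle_XnD1.
rewrite !max_nodes_XnD1 // cexpiDpi modulus_parallelogram modulus1 modulus_cexpi.
have -> : 1 - 2 / n%:R * (n%:R / 2) = 0 :> R.
  by field; rewrite pnatr_eq0 -lt0n.
rewrite mulr0 mul0r subr0 expr1n.
have -> : 2 * (1 + 1) = 2 ^+ 2 :> R by ring.
by rewrite sqrtr_sqr ger0_norm //; ring.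
Qed.

(** On the circle D_gamma P(z) = n (1 + gamma z^{n-1}), so it suffices to choose
    [z] with gamma z^{n-1} = |gamma|. For n > 1 this is a root extraction; for
    n = 1 the left-hand side is gamma itself, whence the sign condition. *)
Lemma polar_deriv_XnD1_attained n gamma :
  (0 < n)%N -> (n = 1%N -> 0 <= gamma) ->
  exists2 z : R[i], modulus z = 1 &
    modulus (polar_deriv gamma ('X^n + 1)).[z] = n%:R * (1 + modulus gamma).
Proof.
move=> n0 gn1.
have [z z1 gz] : exists2 z : R[i], modulus z = 1
    & gamma * z ^+ n.-1 = (modulus gamma)%:C.
  case: n n0 gn1 => [//|[|n]] _ gn1.
    exists 1; first exact: modulus1.
    by rewrite expr0 mulr1 -normC_modulus ger0_norm ?gn1.
  have [u u1 gE] := modulus_polar_form gamma.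
  have u0 : u != 0 by rewrite -modulus_eq0 u1 oner_eq0.
  exists (n.+1.-root u^-1)%C; last by rewrite rootCK // {1}gE mulfK.
  have /(congr1 (@modulus R))/eqP := rootCK (ltn0Sn n) u^-1.
  by rewrite modulusX modulusV u1 invr1 pexpr_eq1 ?modulus_ge0 // => /eqP.
exists z => //; rewrite (horner_polar_deriv _ _ (size_XnD1 n0)) horner_XnD1.
rewrite derivD -polyC1 derivC addr0 derivXn hornerMn hornerXn.
rewrite -[X in (gamma - z) * X]mulr_natl.
have -> : n%:R * (z ^+ n + 1) + (gamma - z) * (n%:R * z ^+ n.-1)
    = n%:R * (1 + gamma * z ^+ n.-1).
  have -> : z ^+ n = z * z ^+ n.-1 by rewrite -exprS prednK.
  by ring.
have -> : 1 + gamma * z ^+ n.-1 = (1 + modulus gamma)%:C.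
  by rewrite gz rmorphD rmorph1.
by rewrite modulusM modulus_nat modulus_real ger0_norm // addr_ge0 ?modulus_ge0.
Qed.

End Extremal.

Theorem theorem6 (R : realType) :
  (forall (k : R) (n s : nat) (z0 : R[i]) (c : nat -> R[i]) (P : {poly R[i]}),
     0 < k -> k <= 1 -> (s < n)%N -> 1 < modulus z0 ->
     zeros_in_disk_but_one n s k z0 c P ->
     forall (gamma : R[i]) (alpha : R) (z : R[i]),
       modulus gamma <= 1 -> modulus z = 1 ->
       modulus (polar_deriv gamma P).[z]
         <= n%:R / 2 * polar_bracket n s k z0 c P gamma alpha z)
  /\
  (forall (n : nat) (gamma : R[i]) (alpha : R),
     (0 < n)%N -> modulus gamma <= 1 -> (n = 1%N -> 0 <= gamma) ->
     (* best possible for s = 0 and k = 1 *)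
     (forall K : R,
        (forall (z0 : R[i]) (c : nat -> R[i]) (P : {poly R[i]}) (z : R[i]),
           1 < modulus z0 -> zeros_in_disk_but_one n 0 1 z0 c P ->
           modulus z = 1 ->
           modulus (polar_deriv gamma P).[z]
             <= K * polar_bracket n 0 1 z0 c P gamma alpha z) ->
        n%:R / 2 <= K)
     /\
     (* equality for z ^ n + 1 *)
     (forall z0 : R[i], 1 < modulus z0 ->
        let P : {poly R[i]} := 'X^n + 1 in
        let c := fun v : nat => P`_v in
        zeros_in_disk_but_one n 0 1 z0 c P /\
        exists z : R[i], modulus z = 1 /\
          modulus (polar_deriv gamma P).[z]
            = n%:R / 2 * polar_bracket n 0 1 z0 c P gamma alpha z)).
Proof.
split=> [k n s z0 c P k0 k1 ltsn z01 zP gamma alpha z g1 z1|].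
  exact: polar_deriv_bound.
move=> n gamma alpha n0 g1 gn1.
have [z z1 attained] := polar_deriv_XnD1_attained n0 gn1.
split=> [K boundK|z0 z01 /=]; last first.
  split; first exact: zeros_in_disk_XnD1.
  by exists z; split=> //; rewrite attained polar_bracket_XnD1 //; field.
(* For s = 0 the point z0 is not a zero, only a point outside the disk. *)
have two1 : 1 < modulus (2 : R[i]) by rewrite modulus_nat ltr1n.
have := boundK _ _ _ z two1 (zeros_in_disk_XnD1 n0 two1) z1.
rewrite attained polar_bracket_XnD1 // mulrA ler_pM2r.
  by rewrite ler_pdivrMr.
by rewrite ltr_pwDl ?modulus_ge0.
Qed.
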